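(* Let $p$ be a prime and let $G$ be a nilpotent periodic locally compact $p$-group such that $\mathrm{rank}_p(G)$ is finite. Then every continuous automorphism of $G$ has finite topological entropy.
   Context: All locally compact groups are Hausdorff topological groups. A locally compact group $G$ is periodic if the connected component of its identity is trivial and $\overline{\langle g\rangle}$ is compact for every $g \in G$. A locally compact group $G$ is a $p$-group if $\lim_{k\to\infty} g^{p^k} = 1$ for every $g \in G$. Finite $p$-rank. A topological group $H$ is topologically finitely generated if $H = \overline{\langle X\rangle}$ for some finite $X \subseteq H$. For a topologically finitely generated locally compact $p$-group $H$ let $d(H) = \min\{|Y| \mid Y \subseteq H,\ \overline{\langle Y\rangle} = H\}$. For a locally compact $p$-group $G$, $\mathrm{rank}_p(G)$ is the maximum of $d(H)$ over all topologically finitely generated closed subgroups $H$ of $G$; $\mathrm{rank}_p(G)$ is finite if this maximum exists (for instance $\mathrm{rank}_p(\mathbb{Q}_p)=1$). Topological entropy. Let $G$ be a locally compact group with left Haar measure $\mu$, let $\mathcal{CT}(G)$ be the set of compact neighborhoods of the identity of $G$, and let $\varphi$ be a continuous endomorphism of $G$. For $V \in \mathcal{CT}(G)$ and $n \ge 1$ put $C_n(\varphi, V) = V \cap \varphi^{-1}(V) \cap \dots \cap \varphi^{-n+1}(V)$. The topological entropy of $\varphi$ is $$\mathsf{h}_{\mathsf{top}}(\varphi) = \sup\left\{ \limsup_{n\to\infty} \frac{-\log \mu(C_n(\varphi, V))}{n} \ \Big|\ V \in \mathcal{CT}(G)\right\} \in [0, +\infty].$$ A continuous automorphism of $G$ is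 a group automorphism that is also a homeomorphism. *)

(* Defs.v *)
From HB Require Import structures.
From mathcomp Require Import all_boot all_order all_algebra.
From mathcomp Require Import all_classical all_reals all_analysis.

Set Implicit Arguments.
Unset Strict Implicit.
Unset Printing Implicit Defensive.

Local Open Scope classical_set_scope.
Local Open Scope card_scope.
Local Open Scope ring_scope.
Local Open Scope group_scope.

(* The distinguished point is unused data: the library's measurable types are
   pointed, and every group has the point 1. *)
HB.mixin Record isTopologicalGroup G & Pointed G & Topological G & Group G := {
  mulg_continuous : continuous (fun x : G * G => x.1 * x.2) ;
  invg_continuous : continuous (fun x : G => x^-1)
}.

#[short(type="topologicalGroupType")]
HB.structure Definition TopologicalGroup :=
  {G of Pointed G & Topological G & Group G & isTopologicalGroup G}.

Definition locally_compact_group (G : topologicalGroupType) : Prop :=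
  hausdorff_space G /\ locally_compact [set: G].

Definition subgroup (G : groupType) (H : set G) : Prop := group_closed (mem H).

Definition subgroup_generated (G : groupType) (X : set G) : set G :=
  smallest (@subgroup G) X.

Fixpoint lower_central (G : groupType) (n : nat) : set G :=
  if n is m.+1 then
    subgroup_generated [set [~ x, y] | x in @lower_central G m & y in [set: G]]
  else [set: G].

Definition nilpotent_group (G : groupType) : Prop :=
  exists n, @lower_central G n = [set 1].

Definition topgen (G : topologicalGroupType) (X : set G) : set G :=
  closure (subgroup_generated X).

Definition periodic_group (G : topologicalGroupType) : Prop :=
  connected_component [set: G] 1 = [set 1] /\
  forall g : G, compact (topgen [set g]).

Definition topological_p_group (p : nat) (G : topologicalGroupType) : Prop :=
  forall g : G, (fun k : nat => g ^+ (p ^ k)%N) @ \oo --> (1 : G).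

Definition top_fg (G : topologicalGroupType) (H : set G) : Prop :=
  exists X : set G, [/\ finite_set X, X `<=` H & topgen X = H].

Definition topgen_cards (G : topologicalGroupType) (H : set G) : set nat :=
  [set n | exists Y : set G, [/\ Y #= `I_n, Y `<=` H & topgen Y = H]].

(* Meaningful when top_fg H holds: then topgen_cards H is nonempty and its
   least element is the only candidate for get. *)
Definition min_gens (G : topologicalGroupType) (H : set G) : nat :=
  get [set n | topgen_cards H n /\ lbound (topgen_cards H) n].

Definition gens_numbers (G : topologicalGroupType) : set nat :=
  [set min_gens H | H in [set H : set G | [/\ subgroup H, closed H & top_fg H]]].

Definition is_rank (G : topologicalGroupType) (r : nat) : Prop :=
  gens_numbers G r /\ ubound (gens_numbers G) r.

Definition finite_rank (G : topologicalGroupType) : Prop :=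
  exists r, is_rank G r.

Local Open Scope ereal_scope.

Definition borel (G : topologicalGroupType) := g_sigma_algebraType (@open G).

(* Radon normalization: outer regular on Borel sets, inner regular on open sets
   only, since G need not be sigma-compact. *)
Definition left_haar (R : realType) (G : topologicalGroupType)
    (mu : {measure set (borel G) -> \bar R}) : Prop :=
  [/\ mu [set: G] != 0,
      forall (x : G) (A : set (borel G)), measurable A ->
        mu [set (x * y)%g | y in (A : set G)] = mu A,
      forall K : set G, compact K -> mu K < +oo,
      forall A : set (borel G), measurable A ->
        mu A = ereal_inf [set mu U | U in [set U : set G | open U /\ A `<=` U]]
    & forall U : set G, open U ->
        mu U = ereal_sup [set mu K | K in [set K : set G | compact K /\ K `<=` U]]].

Definition cotrajectory (G : Type) (phi : G -> G) (V : set G) (n : nat) :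
  set G := \bigcap_(k < n) (iter k phi @^-1` V).

(* cotrajectory phi V n is closed, hence Borel, when G is Hausdorff and V is
   compact. The term n = 0 of the sequence is junk (0^-1 = 0), which the limsup
   ignores. *)
Definition htop (R : realType) (G : topologicalGroupType)
    (mu : {measure set (borel G) -> \bar R}) (phi : G -> G) : \bar R :=
  ereal_sup [set limn_esup
      (fun n => - lne (mu (cotrajectory phi V n)) * (n%:R^-1)%R%:E)
    | V in [set V : set G | nbhs (1%g : G) V /\ compact V]].

Definition continuous_automorphism (G : topologicalGroupType) (phi : G -> G) :
    Prop :=
  [/\ {morph phi : x y / (x * y)%g}, continuous phi
    & exists psi : G -> G, [/\ cancel phi psi, cancel psi phi & continuous psi]].

(* Main.v *)
Require Import Defs.
From mathcomp Require Import all_boot all_order all_algebra finmap.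
From mathcomp Require Import all_classical all_reals all_analysis.
From mathcomp Require Import lra.

(* Fix a compact open subgroup U and let W_k be the closed subgroup generated by
   the p^k-th powers of the elements of U. The W_k form a neighbourhood basis
   of 1. If m is such that phi maps W_m into U, then phi maps W_(k+m) into W_k
   for every k, simply because (u^(p^m))^(p^k) = u^(p^(k+m)). The point is that
   the index of W_(k+m) in W_k is bounded independently of k: W_k is generated
   modulo W_(k+m) by elements of order dividing p^m, so every section of the
   lower central series of the quotient is abelian of exponent dividing p^m and
   of rank at most r, whence the index is at most b = ((p^m)^r)^c for
   nilpotency class c. Therefore C_n(phi, W_k) has index at most b^n in W_k, and
   the entropy of phi is at most log b (below, log b + 1 is enough). *)

Set Implicit Arguments.
Unset Strict Implicit.
Unset Printing Implicit Defensive.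

Import Order.TTheory GRing.Theory Num.Theory.

Local Open Scope classical_set_scope.
Local Open Scope group_scope.

(** * Subgroups and coverings by cosets *)

Section Subgroups.
Variable G : groupType.
Implicit Types (A B H K M N X Y : set G) (x y g : G).

Lemma subgroup_closedP H :
  subgroup H <-> H 1 /\ forall x y, H x -> H y -> H (x * y^-1).
Proof.
split=> [[H1 HF]|[H1 HF]].
  by split=> [|x y Hx Hy]; apply/set_mem => //; apply: HF; apply/mem_set.
split=> [|x y /set_mem Hx /set_mem Hy]; apply/mem_set => //.
exact: HF.
Qed.

Lemma subgroup1 H : subgroup H -> H 1.
Proof. by case/subgroup_closedP. Qed.

Lemma subgroupV H x : subgroup H -> H x -> H x^-1.
Proof.
by move=> /subgroup_closedP[H1 HF] Hx; rewrite -(mul1g x^-1); apply: HF.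
Qed.

Lemma subgroupM H x y : subgroup H -> H x -> H y -> H (x * y).
Proof.
move=> sH Hx Hy; rewrite -(invgK y); have /subgroup_closedP[_] := sH.
by apply=> //; exact: subgroupV.
Qed.

Lemma subgroupX H x n : subgroup H -> H x -> H (x ^+ n).
Proof.
move=> sH Hx; elim: n => [|n IH]; first by rewrite expg0; exact: subgroup1.
by rewrite expgS; exact: subgroupM.
Qed.

Lemma subgroupJ H x y : subgroup H -> H x -> H y -> H (x ^ y).
Proof.
by move=> sH Hx Hy; rewrite /conjg; do !apply: subgroupM => //;
  exact: subgroupV.
Qed.

Lemma subgroupR H x y : subgroup H -> H x -> H y -> H [~ x, y].
Proof.
move=> sH Hx Hy; rewrite /commg; apply: subgroupM => //; first exact: subgroupV.
exact: subgroupJ.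
Qed.

Lemma subgroupT : subgroup [set: G].
Proof. by apply/subgroup_closedP. Qed.

Lemma subgroupI H K : subgroup H -> subgroup K -> subgroup (H `&` K).
Proof.
move=> sH sK; apply/subgroup_closedP; split; first by split; apply: subgroup1.
move=> x y [Hx Kx] [Hy Ky].
by split; apply: subgroupM => //; apply: subgroupV.
Qed.

Lemma subgroup_generated_subgroup X : subgroup (subgroup_generated X).
Proof.
apply/subgroup_closedP; split=> [H [sH _]|x y Xx Xy H HX].
  exact: subgroup1.
have sH : subgroup H by case: HX.
by apply: subgroupM => //; [apply: Xx|apply: subgroupV => //; apply: Xy].
Qed.

Lemma sub_subgroup_generated X : X `<=` subgroup_generated X.
Proof. by move=> x Xx H [_]; apply. Qed.

Lemma subgroup_generated_min X H :
  subgroup H -> X `<=` H -> subgroup_generated X `<=` H.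
Proof. by move=> sH XH x; apply; split. Qed.

Lemma subgroup_generatedS X Y :
  X `<=` Y -> subgroup_generated X `<=` subgroup_generated Y.
Proof.
move=> XY; apply: subgroup_generated_min (subgroup_generated_subgroup _) _.
by move=> x /XY; exact: sub_subgroup_generated.
Qed.

(** For a subgroup [K], using both [y] and [y^-1] turns this inclusion into the usual equality of
    [H] with its conjugates. *)
Definition normalizes K H := forall x y, H x -> K y -> H (x ^ y).

Lemma normalizesS K K' H : K' `<=` K -> normalizes K H -> normalizes K' H.
Proof. by move=> KK nH x y Hx /KK; apply: nH. Qed.

Lemma subgroup_preim_conj H g : subgroup H -> subgroup [set x | H (x ^ g)].
Proof.
move=> sH; apply/subgroup_closedP; split=> [|x y /= Hx Hy].
  by rewrite /= conj1g; exact: subgroup1.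
by rewrite conjMg conjVg; apply: subgroupM => //; exact: subgroupV.
Qed.

Lemma normalizes_generated K X :
  (forall x y, X x -> K y -> subgroup_generated X (x ^ y)) ->
  normalizes K (subgroup_generated X).
Proof.
move=> XK x y Xx Ky.
have sX := subgroup_generated_subgroup X.
apply: (subgroup_generated_min (subgroup_preim_conj y sX)) Xx => z Xz /=.
exact: XK.
Qed.

Definition setM H N : set G := [set x * y | x in H & y in N].

Lemma sub_setMl H N : subgroup N -> H `<=` setM H N.
Proof.
by move=> sN x Hx; exists x => //; exists 1; rewrite ?mulg1//; exact: subgroup1.
Qed.

Lemma sub_setMr H N : subgroup H -> N `<=` setM H N.
Proof.
by move=> sH x Nx; exists 1; [exact: subgroup1|exists x; rewrite ?mul1g].
Qed.

Lemma subgroup_setM H N :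
  subgroup H -> subgroup N -> normalizes H N -> subgroup (setM H N).
Proof.
move=> sH sN nN; apply/subgroup_closedP; split.
  exact: (sub_setMl sN (subgroup1 sH)).
move=> _ _ [x Hx [a Na <-]] [y Hy [b Nb <-]].
exists (x * y^-1).
  by apply: subgroupM => //; exact: subgroupV.
exists ((a * b^-1) ^ y^-1); last by rewrite /conjg !gnorm.
apply: nN; last exact: subgroupV.
by apply: subgroupM => //; exact: subgroupV.
Qed.

Lemma normalizes_setM K H N :
  normalizes K H -> normalizes K N -> normalizes K (setM H N).
Proof.
move=> nH nN _ g [x Hx [y Ny <-]] Kg; rewrite conjMg.
by exists (x ^ g); [exact: nH|exists (y ^ g) => //; exact: nN].
Qed.

Lemma setM_min H N K : subgroup K -> H `<=` K -> N `<=` K -> setM H N `<=` K.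
Proof.
by move=> sK HK NK _ [x Hx [y Ny <-]]; apply: subgroupM => //; auto.
Qed.

Lemma setMS H H' N : H `<=` H' -> setM H N `<=` setM H' N.
Proof. by move=> HH _ [x /HH Hx [y Ny <-]]; exists x => //; exists y. Qed.

(* The index of H in A is at most n, phrased so as to make sense for any two
   sets; the representatives are not required to lie in A. *)
Definition coset_covered A H (n : nat) :=
  exists2 s : seq G, (size s <= n)%N &
    forall a, A a -> exists2 x, x \in s & H (x^-1 * a).

Lemma coset_coveredS A A' H H' n n' : A' `<=` A -> H `<=` H' -> (n <= n')%N ->
  coset_covered A H n -> coset_covered A' H' n'.
Proof.
move=> AA HH nn [s sn sA]; exists s; first exact: leq_trans nn.
by move=> a /AA /sA[x xs /HH]; exists x.
Qed.

Lemma coset_covered_refl H : coset_covered H H 1.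
Proof. by exists [:: 1] => // a Ha; exists 1; rewrite ?inE// invg1 mul1g. Qed.

Lemma coset_covered_trans A H K m n :
  coset_covered A H m -> coset_covered H K n -> coset_covered A K (m * n).
Proof.
move=> [s sm sA] [t tn tH]; exists [seq x * y | x <- s, y <- t].
  by rewrite size_allpairs leq_mul.
move=> a /sA[x xs /tH[y yt Ky]]; exists (x * y); first exact: allpairs_f.
by rewrite invgM -mulgA.
Qed.

Lemma coset_covered_inner A H n : subgroup H -> coset_covered A H n ->
  exists2 s : seq G, (size s <= n)%N &
    (forall x, x \in s -> A x) /\
    forall a, A a -> exists2 x, x \in s & H (x^-1 * a).
Proof.
move=> sH [s sn sA].
(* The covering claim is restricted to the points that [s] covers, so that it can be proved by
   induction on [s]. *)
suff [t ts [tA tH]] : exists2 t : seq G, (size t <= size s)%N &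
    (forall x, x \in t -> A x) /\
    forall a, A a -> (exists2 x, x \in s & H (x^-1 * a)) ->
      exists2 x, x \in t & H (x^-1 * a).
  exists t; first exact: leq_trans sn.
  by split=> // a Aa; apply: tH => //; exact: sA.
elim: s {sn sA} => [|x s [t ts [tA tH]]].
  by exists [::] => //; split=> // a _ [].
have [[a [Aa Hxa]]|noa] := pselect (exists a, A a /\ H (x^-1 * a)).
  exists (a :: t) => //; split=> [y|b Ab [y]].
    by rewrite inE => /predU1P[->//|/tA].
  rewrite inE => /predU1P[->|ys] Hyb.
    exists a; first exact: mem_head.
    have -> : a^-1 * b = (x^-1 * a)^-1 * (x^-1 * b) by rewrite !gnorm.
    by apply: subgroupM => //; exact: subgroupV.
  have [z zt Hz] := tH b Ab (ex_intro2 _ _ y ys Hyb).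
  by exists z => //; rewrite inE zt orbT.
exists t; first exact: leqW.
split=> // b Ab [y]; rewrite inE => /predU1P[->|ys] Hyb.
  by exfalso; apply: noa; exists b.
by apply: tH => //; exists y.
Qed.

(** With representatives [x] chosen in both [A] and [K], the element [x^-1 * a] lies in [K]
    automatically. *)
Lemma coset_coveredI A H K n : subgroup H -> subgroup K ->
  coset_covered A H n -> coset_covered (A `&` K) (H `&` K) n.
Proof.
move=> sH sK cAH.
have [|s sn [sAK sH']] := @coset_covered_inner (A `&` K) H n sH.
  by apply: coset_coveredS cAH => //; exact: subIsetl.
exists s => // a AKa; have [x xs Hxa] := sH' a AKa; exists x => //; split=> //.
apply: subgroupM => //; last by case: AKa.
by apply: subgroupV => //; case: (sAK _ xs).
Qed.

(** * Preimages and cotrajectories of subgroups under an automorphism *)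

Section Automorphism.
Variables phi psi : G -> G.
Hypotheses (phiM : {morph phi : x y / x * y}) (psiK : cancel psi phi).

Let phi1 : phi 1 = 1.
Proof. by apply: (@mulgI _ (phi 1)); rewrite -phiM !mulg1. Qed.

Let phiV x : phi x^-1 = (phi x)^-1.
Proof. by apply: (@mulgI _ (phi x)); rewrite -phiM !mulgV. Qed.

Lemma morphX n : {morph phi : x / x ^+ n}.
Proof. by move=> x; elim: n => [//|n IH]; rewrite !expgS phiM IH. Qed.

Lemma subgroup_preimage H : subgroup H -> subgroup (phi @^-1` H).
Proof.
move=> sH; apply/subgroup_closedP; split; first by rewrite /= phi1;
  exact: subgroup1.
by move=> x y /= Hx Hy; rewrite phiM phiV; apply: subgroupM => //;
  exact: subgroupV.
Qed.

Lemma coset_covered_preimage A H n :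
  coset_covered A H n -> coset_covered (phi @^-1` A) (phi @^-1` H) n.
Proof.
move=> [s sn sA]; exists [seq psi x | x <- s]; first by rewrite size_map.
move=> a /sA[x xs Hx]; exists (psi x); first exact: map_f.
by rewrite /= phiM phiV psiK.
Qed.

Lemma cotrajectory1 H : cotrajectory phi H 1 = H.
Proof.
apply/seteqP; split=> [x /(_ 0)|x Hx [|k]//]; exact.
Qed.

Lemma cotrajectoryS H n :
  cotrajectory phi H n.+2 = (phi @^-1` cotrajectory phi H n.+1) `&` H.
Proof.
apply/seteqP; split=> [x Hx|x [Hphi Hx] [|k] kn //].
  split=> [k kn|]; last exact: (Hx 0).
  by rewrite /= -iterSr; exact: (Hx k.+1).
by rewrite /= -iterS iterSr; exact: Hphi.
Qed.

Lemma subgroup_cotrajectory H n :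
  subgroup H -> subgroup (cotrajectory phi H n.+1).
Proof.
move=> sH; elim: n => [|n IH]; first by rewrite cotrajectory1.
by rewrite cotrajectoryS; apply: subgroupI => //; exact: subgroup_preimage.
Qed.

(** With [C] the preceding cotrajectory, descend from [H] to [phi^-1(H)] met with [H], then to
    [phi^-1(C)] met with [H]. The first step costs [b]; the second is the covering of [H] by cosets
    of [C], pulled back along [phi] and intersected with [H]. *)
Lemma coset_covered_cotrajectory H b n : subgroup H ->
  coset_covered H ((phi @^-1` H) `&` H) b ->
  coset_covered H (cotrajectory phi H n.+1) (b ^ n).
Proof.
move=> sH cH; elim: n => [|n IH].
  by rewrite cotrajectory1; exact: coset_covered_refl.
rewrite cotrajectoryS expnS; apply: coset_covered_trans cH _.
apply: coset_coveredI => //; last exact: coset_covered_preimage.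
exact/subgroup_preimage/subgroup_cotrajectory.
Qed.

End Automorphism.

End Subgroups.

(** * The index of a normal subgroup of a nilpotent group *)

Section NilpotentCover.
Variable G : groupType.
Implicit Types (A H K M N X : set G) (x y a g : G).

(** Modulo [N] the element [x] commutes with the powers of [y]; [t] collects the commutators that
    appear when each new [x] is moved to the left. *)
Lemma expMg_mod K N x y n : subgroup N -> normalizes K N -> K x -> K y ->
  (forall j, N [~ y ^+ j, x]) -> subgroup K ->
  exists2 t, N t & (x * y) ^+ n = x ^+ n * y ^+ n * t.
Proof.
move=> sN nN Kx Ky Nyx sK; elim: n => [|n [t Nt IH]].
  by exists 1; [exact: subgroup1|rewrite !mulg1].
exists ([~ y ^+ n, x] ^ y * t ^ (x * y)).
  by apply: subgroupM => //; apply: nN => //; exact: subgroupM.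
by rewrite !expgSr IH /commg /conjg !gnorm.
Qed.

(** In [[~ a * b, g] = [~ a, g] ^ b * [~ b, g]] with [b] a power of [a], the conjugation by [b] is
    trivial modulo [N]. *)
Lemma commXg_mod K N a g n : subgroup N -> normalizes K N -> subgroup K ->
  K a -> K g -> (forall j, N [~ [~ a, g], a ^+ j]) ->
  exists2 t, N t & [~ a ^+ n, g] = [~ a, g] ^+ n * t.
Proof.
move=> sN nN sK Ka Kg Nag; elim: n => [|n [t Nt IH]].
  by exists 1; [exact: subgroup1|rewrite comm1g mulg1].
set c := [~ a, g] in IH Nag *.
exists ([~ c, a ^+ n] ^ (c ^+ n) * t).
  by apply: subgroupM => //; apply: nN => //; apply: subgroupX => //;
    exact: subgroupR.
have -> : [~ a ^+ n.+1, g] = c ^ (a ^+ n) * [~ a ^+ n, g].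
  by rewrite expgS /c /commg /conjg !gnorm.
by rewrite IH expgS /commg /conjg !gnorm.
Qed.

(** In the abelian group [A/N] each member of [Y] has order dividing [q], so adjoining one generator
    multiplies the index by at most [q]. *)
Lemma coset_covered_abelian A N (q : nat) (Y : seq G) :
  (0 < q)%N -> subgroup A -> subgroup N -> N `<=` A ->
  (forall x y, A x -> A y -> N [~ x, y]) ->
  (forall y, y \in Y -> A y /\ N (y ^+ q)) ->
  coset_covered (subgroup_generated ([set` Y] `|` N)) N (q ^ size Y).
Proof.
move=> q_gt0 sA sN NA NR; elim: Y => [|y Y IH] YA.
  have [s ss sN'] := coset_covered_refl N.
  exists s => // x Xx; apply: sN'; apply: subgroup_generated_min Xx => //.
  by move=> z [].
have {}IH : coset_covered (subgroup_generated ([set` Y] `|` N)) N (q ^ size Y).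
  by apply: IH => z zY; apply: YA; rewrite inE zY orbT.
have [Ay Nyq] := YA y (mem_head _ _).
set H := subgroup_generated _ in IH.
have sH : subgroup H by exact: subgroup_generated_subgroup.
have NH : N `<=` H by move=> x Nx; apply: sub_subgroup_generated; right.
have HA : H `<=` A.
  apply: subgroup_generated_min => // z [/= zY|/NA//].
  by case: (YA z); rewrite // inE zY orbT.
have YH : [set` Y] `<=` H by move=> x Yx; apply: sub_subgroup_generated; left.
clearbody H.
(* A subgroup between [N] and [A] contains the commutators of [A], hence is normal in [A]. *)
have nH : normalizes A H.
  move=> h a Hh Aa; rewrite -(mulVKg h (h ^ a)) -/(commg h a).
  by apply: subgroupM => //; apply/NH/NR => //; exact: HA.
(* [T] is the subgroup generated by [H] and [y]; natural exponents suffice because [y ^+ q] lies in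
   [H]. *)
pose T := [set x | A x /\ exists e, H (x * y ^+ e)].
have sT : subgroup T.
  suff TM x z : T x -> T z -> T (x * z).
    apply/subgroup_closedP; split=> [|x z Tx [Az [e Hze]]].
      split; first exact: subgroup1.
      by exists 0; rewrite mulg1; exact: subgroup1.
    apply: TM => //; split; first exact: subgroupV.
    (* This is [-e] modulo [q]; the subtraction is not truncated because [0 < q]. *)
    exists (e * q - e)%N.
    have -> : z^-1 * y ^+ (e * q - e) =
        y ^+ (e * q) * ((z * y ^+ e)^-1 ^ y ^+ (e * q - e)).
      rewrite -{2}(@subnKC e (e * q)) ?leq_pmulr// expgnDr /conjg.
      by rewrite !gnorm.
    apply: subgroupM => //.
      by rewrite mulnC expgnA; apply: subgroupX => //; exact: NH.
    by apply: nH; [exact: subgroupV|exact: subgroupX].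
  move=> [Ax [e Hxe]] [Az [f Hzf]]; split; first exact: subgroupM.
  exists (f + e)%N.
  have -> : x * z * y ^+ (f + e) = (x * y ^+ e) * ((z * y ^+ f) ^ y ^+ e).
    by rewrite expgnDr /conjg !gnorm.
  by apply: subgroupM => //; apply: nH => //; exact: subgroupX.
rewrite expnS.
apply: coset_covered_trans IH.
(* The exponent attached to [x] by [T] is reduced modulo [q], which leaves [q] representatives. *)
exists [seq (y ^+ j)^-1 | j <- iota 0 q]; first by rewrite size_map size_iota.
move=> x Xx.
have [Ax [e Hxe]] : T x.
  apply: subgroup_generated_min Xx => // z [|Nz].
    rewrite /= inE => /predU1P[->|zY].
      split=> //; exists q.-1; rewrite -expgS prednK//; exact: NH.
    split; first by case: (YA z); rewrite // inE zY orbT.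
    by exists 0; rewrite mulg1; exact: YH.
  by split; [exact: NA|exists 0; rewrite mulg1; exact: NH].
exists (y ^+ (e %% q))^-1.
  by apply: map_f; rewrite mem_iota add0n ltn_mod.
rewrite invgK.
have -> : y ^+ (e %% q) * x = (x * y ^+ (e %% q)) ^ (y ^+ (e %% q))^-1.
  by rewrite /conjg !gnorm.
apply: nH; last by apply: subgroupV => //; exact: subgroupX.
have -> : x * y ^+ (e %% q) = (x * y ^+ e) * (y ^+ (e %/ q * q))^-1.
  by rewrite {2}(divn_eq e q) addnC expgnDr !gnorm.
apply: subgroupM => //; apply: subgroupV => //.
by rewrite mulnC expgnA; apply: subgroupX => //; exact: NH.
Qed.

(** * The lower central series modulo a normal subgroup *)

Section LowerCentralModulo.
Variables (K M : set G).
Hypotheses (sK : subgroup K) (sM : subgroup M) (MK : M `<=` K).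
Hypothesis nM : normalizes K M.

(** This is the preimage in [K] of the lower central series of [K/M]; working with preimages avoids
    forming the quotient. *)
Fixpoint lower_central_mod (i : nat) : set G :=
  if i is j.+1 then
    subgroup_generated
      ([set [~ a, g] | a in lower_central_mod j & g in K] `|` M)
  else K.
Local Notation D := lower_central_mod.

Lemma subgroup_lower_central_mod i : subgroup (D i).
Proof. by case: i => [//|i]; exact: subgroup_generated_subgroup. Qed.
Local Notation sD := subgroup_lower_central_mod.

Lemma sub_lower_central_mod i : M `<=` D i.
Proof. by case: i => [//|i] x Mx; apply: sub_subgroup_generated; right. Qed.
Local Notation MD := sub_lower_central_mod.

Lemma lower_central_modR i a g : D i a -> K g -> D i.+1 [~ a, g].
Proof.
by move=> Da Kg; apply: sub_subgroup_generated; left; exists a => //; exists g.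
Qed.
Local Notation DR := lower_central_modR.

Lemma normalizes_lower_central_mod i : normalizes K (D i).
Proof.
elim: i => [|i IH]; first by move=> x y Kx Ky; exact: subgroupJ.
apply: normalizes_generated => x y [[a Da [g Kg <-]]|Mx] Ky; last first.
  exact: (@MD i.+1 _ (nM Mx Ky)).
by rewrite conjRg; apply: (@DR i); [exact: IH|exact: subgroupJ].
Qed.
Local Notation nD := normalizes_lower_central_mod.

Lemma lower_central_mod_decr i : D i.+1 `<=` D i.
Proof.
apply: subgroup_generated_min (sD i) _ => x [[a Da [g Kg <-]]|/MD//].
by rewrite /commg; apply: subgroupM (sD i) _ _;
  [exact: subgroupV (sD i) Da|exact: nD].
Qed.
Local Notation DS := lower_central_mod_decr.

Lemma lower_central_mod_sub i : D i `<=` K.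
Proof. by elim: i => [//|i IH] x /DS /IH. Qed.
Local Notation DK := lower_central_mod_sub.

Variables (q : nat) (S : set G).
Hypotheses (SK : S `<=` K) (genS : K `<=` subgroup_generated (S `|` M)).
Hypothesis Sq : forall s, S s -> M (s ^+ q).

(** [D i] is central in [K] modulo [D i.+1], so taking [q]-th powers is an endomorphism of the
    section, and this set is the preimage of its kernel. The exponent thus has to be checked on
    generators only. *)
Let subgroup_exponent i :
  subgroup [set x | D i x /\ D i.+1 (x ^+ q)].
Proof.
have sDi := sD i; have sDi1 := sD i.+1.
apply/subgroup_closedP; split=> [|x y [Dx Dxq] [Dy Dyq]].
  by split; [exact: subgroup1|rewrite /= expg1n; exact: subgroup1].
split; first by apply: subgroupM => //; exact: subgroupV.
have Kx := DK Dx; have Kyv := subgroupV sK (DK Dy).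
have Dyx j : D i.+1 [~ y^-1 ^+ j, x].
  by apply: (@DR i) Kx; apply: subgroupX => //; exact: subgroupV.
have [t Dt ->] := expMg_mod q sDi1 (@nD i.+1) Kx Kyv Dyx sK.
apply: (subgroupM sDi1) Dt; apply: (subgroupM sDi1) Dxq _.
by rewrite expVgn; exact: (subgroupV sDi1).
Qed.

(* The exponent of every section of the series divides that of the first one:
   modulo [D i.+2], the commutator [[~ a, g]] is a homomorphism in [a]. *)
Lemma lower_central_mod_exponent i a : D i a -> D i.+1 (a ^+ q).
Proof.
elim: i a => [|i IH] a Da.
  suff [] : [set x | D 0 x /\ D 1 (x ^+ q)] a by [].
  apply: (subgroup_generated_min (subgroup_exponent 0)) (genS Da) => x [Sx|Mx].
    by split; [exact: SK|exact: (@MD 1 _ (Sq Sx))].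
  by split; [exact: MK|exact: (@MD 1 _ (subgroupX q sM Mx))].
suff [] : [set x | D i.+1 x /\ D i.+2 (x ^+ q)] a by [].
apply: (subgroup_generated_min (subgroup_exponent i.+1)) Da => x.
move=> [[b Db [g Kg <-]]|Mx]; last first.
  by split; [exact: (@MD i.+1)|exact: (@MD i.+2 _ (subgroupX q sM Mx))].
split; first exact: (@DR i).
have Kb := DK Db.
have Dbg j : D i.+2 [~ [~ b, g], b ^+ j].
  by apply: (@DR i.+1); [exact: DR|exact: subgroupX].
have [t Dt E] := commXg_mod q (sD i.+2) (@nD i.+2) sK Kb Kg Dbg.
have -> : [~ b, g] ^+ q = [~ b ^+ q, g] * t^-1 by rewrite E mulgK.
apply: (subgroupM (sD i.+2)); last exact: (subgroupV (sD i.+2)).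
by apply: (@DR i.+1) => //; exact: IH.
Qed.

Lemma subgroup_lower_central n : subgroup (@lower_central G n).
Proof. by case: n => [|n];
  [exact: subgroupT|exact: subgroup_generated_subgroup]. Qed.

Lemma lower_central_conj n x y : @lower_central G n x ->
  @lower_central G n (x ^ y).
Proof.
elim: n x y => [//|n IH] x y Lx.
apply: (normalizes_generated (K := setT)) Lx _ => //.
move=> _ z [a La [g _ <-]] _; rewrite conjRg.
apply: sub_subgroup_generated; exists (a ^ z); first exact: IH.
by exists (g ^ z).
Qed.

(** For [a = b * m] one has [[~ a, g] = [~ b, g] ^ m * [~ m, g]]: the first factor stays in the
    lower central term, which is normal, and the second in [M]. When that term is trivial, this puts
    [D n] inside [M]. *)
Lemma lower_central_mod_le n : D n `<=` setM (@lower_central G n) M.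
Proof.
elim: n => [|n IH].
  by move=> x _; exists x => //; exists 1; [exact: subgroup1|rewrite mulg1].
suff sL : subgroup (K `&` setM (lower_central n.+1) M).
  suff DL : D n.+1 `<=` K `&` setM (lower_central n.+1) M by move=> x /DL[].
  apply: subgroup_generated_min => // x [[a Da [g Kg <-]]|Mx]; last first.
    split; first exact: MK.
    exact: (sub_setMr (subgroup_lower_central n.+1) Mx).
  have [b Lb [m Mm E]] := IH _ Da; have Ka := DK Da.
  split; first exact: subgroupR.
  have -> : [~ a, g] = [~ b, g] ^ m * [~ m, g].
    by rewrite -E /commg /conjg !gnorm.
  exists ([~ b, g] ^ m).
    apply: lower_central_conj; apply: sub_subgroup_generated.
    by exists b => //; exists g.
  exists [~ m, g] => //; rewrite /commg; apply: subgroupM => //.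
    exact: subgroupV.
  exact: nM.
apply/subgroup_closedP; split.
  split; first exact: subgroup1.
  exact: (sub_setMl sM (subgroup1 (subgroup_lower_central n.+1))).
move=> x y [Kx [a La [m Mm Ex]]] [Ky [b Lb [m' Mm' Ey]]].
split; first by apply: subgroupM => //; exact: subgroupV.
have sL := subgroup_lower_central n.+1.
exists (a * (b^-1 ^ (m * m'^-1)^-1)).
  by apply: (subgroupM sL) => //; apply: lower_central_conj;
    exact: (subgroupV sL).
exists (m * m'^-1); first by apply: subgroupM => //; exact: subgroupV.
by rewrite -Ex -Ey /conjg !gnorm.
Qed.

(** The series descends from [K] into [M] in [c] steps. Each section is abelian of exponent dividing
    [q] with at most [r] generators, so each step costs at most [q ^ r]; the generator hypothesis is
    applied with [A] equal to each [D i]. *)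
Lemma coset_covered_nilpotent (r c : nat) : (0 < q)%N ->
  @lower_central G c = [set 1] ->
  (forall A, subgroup A -> M `<=` A -> A `<=` K ->
    exists Y : seq G, [/\ (size Y <= r)%N, forall y, y \in Y -> A y
      & A `<=` subgroup_generated ([set` Y] `|` M)]) ->
  coset_covered K M ((q ^ r) ^ c).
Proof.
move=> q_gt0 Lc genr.
suff cD i : coset_covered K (D i) ((q ^ r) ^ i).
  apply: coset_coveredS (cD c) => // x /lower_central_mod_le[y].
  by rewrite Lc => -> [m Mm <-]; rewrite mul1g.
elim: i => [|i IH]; first exact: coset_covered_refl.
rewrite expnSr; apply: coset_covered_trans IH _.
have [Y [Yr YD DY]] := genr _ (sD i) (@MD i) (@DK i).
have cY : coset_covered (subgroup_generated ([set` Y] `|` D i.+1)) (D i.+1)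
    (q ^ size Y).
  apply: (@coset_covered_abelian (D i)) => //.
  - exact: sD.
  - exact: (sD i.+1).
  - exact: DS.
  - by move=> x y Dx Dy; apply: (@DR i) => //; exact: DK Dy.
  - by move=> y yY; split;
    [exact: YD|exact: (lower_central_mod_exponent (YD y yY))].
apply: coset_coveredS cY => //; last exact: leq_pexp2l.
apply: subset_trans DY _; apply: subgroup_generatedS => x [Yx|Mx];
  [by left|right].
exact: (@MD i.+1).
Qed.

End LowerCentralModulo.
End NilpotentCover.

(** * Locally compact totally disconnected groups *)

Section TopologicalGroups.
Variable G : topologicalGroupType.
Implicit Types (A C H K M N O U V : set G) (x y g : G).

Lemma cvgMg (T : Type) (F : set_system T) (f g : T -> G) (a b : G) :
  Filter F -> f @ F --> a -> g @ F --> b -> (fun t => f t * g t) @ F --> a * b.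
Proof.
move=> FF fa gb.
apply: (@cvg_comp _ _ _ (fun t => (f t, g t)) (fun z : G * G => z.1 * z.2)).
  exact: cvg_pair fa gb.
exact: (@mulg_continuous G (a, b)).
Qed.

Lemma cvgVg (T : Type) (F : set_system T) (f : T -> G) (a : G) :
  Filter F -> f @ F --> a -> (fun t => (f t)^-1) @ F --> a^-1.
Proof.
move=> FF fa; apply: (@cvg_comp _ _ _ f (fun z : G => z^-1)); first exact: fa.
exact: (@invg_continuous G a).
Qed.

Lemma mulgl_continuous x : continuous (fun y : G => x * y).
Proof. by move=> y; apply: cvgMg; [exact: cvg_cst|exact: cvg_id]. Qed.

Lemma mulgr_continuous x : continuous (fun y : G => y * x).
Proof. by move=> y; apply: cvgMg; [exact: cvg_id|exact: cvg_cst]. Qed.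

Lemma expgn_continuous n : continuous (fun y : G => y ^+ n).
Proof.
move=> y; elim: n => [|n IH]; first exact: cvg_cst.
rewrite (_ : (fun y : G => y ^+ n.+1) = (fun z : G => z * z ^+ n)).
  by apply: cvgMg; [exact: cvg_id|exact: IH].
by apply/funext => z; rewrite expgS.
Qed.

Lemma nbhs_mulgl x y V : nbhs (x * y) V -> nbhs y [set z | V (x * z)].
Proof. exact: mulgl_continuous. Qed.

Lemma nbhs_translate x V : nbhs (1 : G) V -> nbhs x [set z | V (x^-1 * z)].
Proof. by move=> V1; apply: nbhs_mulgl; rewrite mulVg. Qed.

(** The tube lemma: compactness of [K] makes the neighbourhood of the parameter [i0] uniform in [a].
    Openness of stabilizers and of normal cores follows from it. *)
Lemma tube (I : topologicalType) (i0 : I) (f : G -> I -> G) K O :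
  compact K -> open O ->
  (forall a, K a -> (fun z : G * I => f z.1 z.2) @ nbhs (a, i0) --> f a i0) ->
  (forall a, K a -> O (f a i0)) ->
  \forall i \near i0, forall a, K a -> O (f a i).
Proof.
move=> /compact_near_coveringP cK oO fc KO.
apply: (cK I (nbhs i0) (fun i x => O (f x i))) => a Ka.
apply: (fc a Ka O); apply: open_nbhs_nbhs; split=> //; exact: KO.
Qed.

Lemma subgroup_open H : subgroup H -> nbhs (1 : G) H -> open H.
Proof.
move=> sH H1; rewrite openE => x Hx; rewrite /interior.
apply: filterS (nbhs_translate x H1) => z /= Hz.
by rewrite -(mulVKg x z); exact: subgroupM.
Qed.

Lemma open_subgroup_nbhs H : subgroup H -> open H -> nbhs (1 : G) H.
Proof. by move=> sH oH; apply: open_nbhs_nbhs; split=> //;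
  exact: subgroup1. Qed.

(** The coset [xH] is a neighbourhood of [x], so it meets [A]. *)
Lemma closure_subgroupP A H x : subgroup H -> open H -> closure A x ->
  exists2 a, A a & H (a^-1 * x).
Proof.
move=> sH oH clA.
have [a [Aa Ha]] := clA _ (nbhs_translate x (open_subgroup_nbhs sH oH)).
by exists a => //; rewrite -[a^-1 * x]invgK invgM invgK; exact: subgroupV.
Qed.

Lemma open_subgroup_closed H : subgroup H -> open H -> closed H.
Proof.
move=> sH oH x /(closure_subgroupP sH oH)[a Ha Hax].
by rewrite -(mulVKg a x); exact: subgroupM.
Qed.

Lemma subgroup_closure H : subgroup H -> subgroup (closure H).
Proof.
move=> sH; apply/subgroup_closedP; split;
  first exact: (subset_closure (subgroup1 sH)).
move=> x y Hx Hy B.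
have c : (fun z : G * G => z.1 * z.2^-1) @ nbhs (x, y) --> x * y^-1.
  by apply: cvgMg; [exact: cvg_fst|apply: cvgVg; exact: cvg_snd].
move=> /c[[P Q] /= [Px Qy] PQB].
have [a [Ha Pa]] := Hx _ Px; have [b [Hb Qb]] := Hy _ Qy.
exists (a * b^-1); split; last exact: (PQB (a, b)).
by apply: subgroupM => //; exact: subgroupV.
Qed.

Lemma subgroup_topgen A : subgroup (topgen A).
Proof. exact/subgroup_closure/subgroup_generated_subgroup. Qed.

Lemma sub_topgen A : A `<=` topgen A.
Proof. by move=> x Ax;
  exact: (subset_closure (@sub_subgroup_generated _ A x Ax)). Qed.

Lemma topgen_min A H : subgroup H -> closed H -> A `<=` H -> topgen A `<=` H.
Proof.
move=> sH cH AH; rewrite /topgen (closure_id H).1//; apply: closureS.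
exact: subgroup_generated_min.
Qed.

(** Modulo an open subgroup, topological generation reduces to abstract generation. *)
Lemma topgen_subM A N : subgroup N -> open N ->
  topgen A `<=` setM (subgroup_generated A) N.
Proof.
move=> sN oN x /(closure_subgroupP sN oN)[a Aa Nx].
by exists a => //; exists (a^-1 * x) => //; rewrite mulVKg.
Qed.

Lemma compact_coset_covered A N : compact A -> nbhs (1 : G) N ->
  exists n, coset_covered A N n.
Proof.
rewrite compact_cover => cA N1.
have [||D DA AD] := cA G A (fun x => [set z | N^° (x^-1 * z)]).
- move=> x _; apply: (@open_comp _ _ (fun z => x^-1 * z));
  last exact: open_interior.
  by move=> z _; exact: mulgl_continuous.
- by move=> x Ax; exists x => //=; rewrite mulVg.
exists (size (enum_fset D)); exists (enum_fset D) => // a /AD[x /= xD Na].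
by exists x => //; exact: interior_subset Na.
Qed.

(* Total disconnectedness enters through the classical fact that, in a compact
   Hausdorff space, the intersection of the clopen neighbourhoods of a point is
   connected. *)
Lemma compact_open_base V : hausdorff_space G -> locally_compact [set: G] ->
  connected_component [set: G] 1 = [set 1] -> nbhs (1 : G) V ->
  exists C, [/\ C `<=` V, compact C, open C & C 1].
Proof.
move=> hG lG cc1 V1.
have [K] := lG 1 I; rewrite withinET => K1 [cK clK].
(* These are the relatively clopen parts of [K] around 1; their intersection [Q] will be shown to be
   connected. *)
pose P C := [/\ C 1, C `<=` K, closed C & exists2 O, open O & C = K `&` O].
have PK : P K.
  split=> //; first exact: nbhs_singleton K1.
  by exists setT; [exact: openT|rewrite setIT].
have PI C D : P C -> P D -> P (C `&` D).
  move=> [C1 CK cC [U oU CE]] [D1 DK cD [U' oU' DE]]; split=> //.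
  - by move=> x [/CK].
  - exact: closedI.
  - by exists (U `&` U'); [exact: openI|rewrite CE DE setIACA setIid].
pose Q := \bigcap_(C in P) C.
have clQ : closed Q by apply: closed_bigI => C [].
have Q1 : Q 1 by move=> C [].
(* Otherwise the sets [C] minus [O] generate a proper filter, and its cluster point in [K] lies in
   [Q] but not in [O]. *)
have shrink O : open O -> Q `<=` O -> exists2 C, P C & C `<=` O.
  move=> oO QO; apply: contrapT => nC.
  pose F := filter_from P (fun C => C `\` O).
  have FF : ProperFilter F.
    apply: filter_from_proper; last first.
      move=> C PC; apply/set0P/negP => /eqP /subsets_disjoint CO.
      by apply: nC; exists C => // x Cx; apply: contrapT => /(conj Cx);
        rewrite -/((C `\` O) x) CO.
    apply: filter_from_filter; first by exists K.
    move=> C D PC PD; exists (C `&` D); first exact: PI.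
    by move=> x [[Cx Dx] Ox].
  have [|z [Kz Fz]] := cK F FF.
    by exists K => // x [].
  have Oz : ~ O z.
    move=> Oz;
      have [|x [[]]] := Fz (K `\` O) O _ (open_nbhs_nbhs (conj oO Oz)) => //.
    by exists K.
  apply: Oz; apply: QO => C PC; have [_ _ clC _] := PC.
  apply: clC => B Bz; have [|x [[Cx _] Bx]] := Fz (C `\` O) B _ Bz.
    by exists C.
  by exists x.
have cQ : connected Q.
  apply/connectedP => E [E0 QE [sE1 sE2]].
  wlog E1 : E E0 QE sE1 sE2 / E false 1.
    move=> W; move: (Q1); rewrite QE => -[E1|E1]; first exact: (W E).
    apply: (W (E \o negb)) => /=; first by move=> b; exact: E0.
    - by rewrite setUC -QE.
    - by rewrite setIC.
    - by rewrite setIC.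
    - exact: E1.
  have clE b : closed (E b).
    move=> x clx; have : Q x.
      apply: clQ; apply: closureS (clx); rewrite QE.
      by case: b {clx} => y ?; [right|left].
    case: b clx => clx; rewrite QE => -[]// Ex; exfalso.
      by have : (E false `&` closure (E true)) x by []; rewrite sE2.
    by have : (closure (E false) `&` E true) x by []; rewrite sE1.
  have E01 : E false `&` E true = set0.
    by apply/seteqP; split=> // x [Ex Ey]; rewrite -sE2; split=> //;
      exact: subset_closure.
  have cE : compact (E false).
    apply: subclosed_compact cK _ => // x Ex.
    by have : Q x; [rewrite QE; left|apply].
  (* Compactness of [E false] gives one [W] that works for all its points; then the open sets made
     of the [W]-translates of the two pieces are disjoint. *)
  have [W [oW W1 WE]] : exists W, [/\ open W, W 1 &
      forall a w w', E false a -> W w -> W w' -> ~ E true (a * w * w'^-1)].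
    have := @tube (G * G)%type (1, 1) (fun a w =>
      a * w.1 * w.2^-1) (E false) (~` E true) cE.
    move=> []; first exact/closed_openC/clE.
    - move=> a _; apply: cvgMg.
        apply: cvgMg; first exact: cvg_fst.
        apply: (@cvg_comp _ _ _ snd fst); [exact: cvg_snd|exact: cvg_fst].
      apply: cvgVg.
      apply: (@cvg_comp _ _ _ snd snd); [exact: cvg_snd|exact: cvg_snd].
    - move=> a Ea /= Eb; rewrite invg1 !mulg1 in Eb.
      by have : (E false `&` E true) a by []; rewrite E01.
    move=> [P1 P2] /= [P11 P21] PE.
    exists (P1^° `&` P2^°); split; first by apply: openI; exact: open_interior.
      by split.
    move=> a w w' Ea [/interior_subset w1 _] [_ /interior_subset w2].
    exact: (PE (w, w')).
  pose O b := \bigcup_(a in E b) [set z | W (a^-1 * z)].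
  have oO b : open (O b).
    apply: bigcup_open => a _.
    apply: (@open_comp _ _ (fun z => a^-1 * z)) => // z _.
    exact: mulgl_continuous.
  have EO b : E b `<=` O b by move=> x Ex; exists x => //=; rewrite mulVg.
  have O01 x : O false x -> O true x -> False.
    move=> [a Ea /= Wa] [b Eb /= Wb]; apply: (WE a _ _ Ea Wa Wb).
    by rewrite !gnorm.
  have [||C PC CO] := shrink (O false `|` O true); first exact: openU.
    by rewrite QE => x [/EO|/EO]; [left|right].
  (* Inside [C] the set [O false] is the complement of [O true], so this part is again relatively
     clopen. It therefore contains [Q], which contradicts the existence of a point in [E true]. *)
  have PCO : P (C `&` O false).
    have [C1 CK cC [U oU CE]] := PC; split.
    - by split=> //; exact: EO.
    - by move=> x [/CK].
    - rewrite (_ : _ `&` _ = C `&` ~` O true).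
        by apply: closedI => //; exact: open_closedC.
      apply/seteqP; split=> x [Cx Ox]; split=> //.
        by move=> Ox'; exact: O01 Ox Ox'.
      by have [] := CO x Cx.
    - by exists (U `&` O false); [exact: openI|rewrite CE setIA].
  have [y Ey] := E0 true.
  have Qy : Q y by rewrite QE; right.
  have [_ Oy] := Qy _ PCO.
  by apply: (O01 y) => //; exact: EO.
have Q_1 : Q `<=` [set 1].
  by rewrite -cc1; apply: connected_component_max.
(* A relatively open part of [K] that lies in the interior of [K] is open in [G]. *)
have [||C PC CO] := shrink (K^° `&` V^°).
- by apply: openI; exact: open_interior.
- by move=> x /Q_1 ->; split.
have [C1 CK cC [U oU CE]] := PC.
exists C; split=> //.
- by move=> x /CO[_ /interior_subset].
- exact: subclosed_compact cK _.
rewrite (_ : C = K^° `&` U); first by apply: openI => //; exact: open_interior.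
apply/seteqP; split=> x.
  by move=> Cx; split; [case: (CO x Cx)|move: Cx; rewrite CE => -[]].
by move=> [/interior_subset Kx Ox]; rewrite CE.
Qed.

(** Van Dantzig's theorem: [N] is the right stabilizer of a compact open [C] around 1. It is open by
    the tube lemma, and contained in [C] because it moves 1 within [C]. *)
Lemma open_subgroup_base V : hausdorff_space G -> locally_compact [set: G] ->
  connected_component [set: G] 1 = [set 1] -> nbhs (1 : G) V ->
  exists N, [/\ N `<=` V, compact N, open N & subgroup N].
Proof.
move=> hG lG cc1 V1.
have [C [CV cC oC C1]] := compact_open_base hG lG cc1 V1.
pose N := [set g | forall c, C c -> C (c * g) /\ C (c * g^-1)].
have sN : subgroup N.
  apply/subgroup_closedP; split=> [c Cc|x y Nx Ny c Cc].
    by rewrite invg1 mulg1.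
  split; rewrite ?invgM ?invgK mulgA.
    by have [+ _] := Nx c Cc; move=> /Ny[].
  by have [+ _] := Ny c Cc; move=> /Nx[].
have NC : N `<=` C by move=> x /(_ _ C1)[]; rewrite mul1g.
have oN : open N.
  apply: subgroup_open => //.
  have t1 : \forall g \near (1 : G), forall c, C c -> C (c * g).
    apply: tube => //; last by move=> c Cc; rewrite mulg1.
    by move=> a _; apply: cvgMg; [exact: cvg_fst|exact: cvg_snd].
  have t2 : \forall g \near (1 : G), forall c, C c -> C (c * g^-1).
    apply: (@tube _ _ (fun c g => c * g^-1)) => //.
      by move=> a _; apply: cvgMg; [exact: cvg_fst|apply: cvgVg;
        exact: cvg_snd].
    by move=> c Cc; rewrite invg1 mulg1.
  by apply: filterS2 t1 t2 => g g1 g2 c Cc; split; [exact: g1|exact: g2].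
exists N; split=> //; first exact: subset_trans CV.
exact: subclosed_compact (open_subgroup_closed sN oN) cC NC.
Qed.

(** [N'] is the intersection of the conjugates of [N] under [U]; compactness of [U] keeps it
    open. *)
Lemma normal_open_core U N : compact U -> subgroup U -> open N -> subgroup N ->
  exists N', [/\ N' `<=` N, open N', subgroup N' & normalizes U N'].
Proof.
move=> cU sU oN sN.
pose N' := [set g | forall u, U u -> N (g ^ u)].
have sN' : subgroup N'.
  apply/subgroup_closedP; split=> [u Uu|x y Nx Ny u Uu].
    by rewrite conj1g; exact: subgroup1.
  rewrite conjMg conjVg; apply: subgroupM => //; first exact: Nx.
  by apply: subgroupV => //; exact: Ny.
exists N'; split=> //.
- by move=> x /(_ _ (subgroup1 sU)); rewrite conjg1.
- apply: subgroup_open => //.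
  apply: (@tube _ _ (fun u g => g ^ u)) => //.
    move=> a _; apply: cvgMg; first by apply: cvgVg; exact: cvg_fst.
    by apply: cvgMg; [exact: cvg_snd|exact: cvg_fst].
  by move=> u Uu; rewrite conj1g; exact: subgroup1.
- move=> x u Nx Uu v Uv; rewrite -conjgM; apply: Nx.
  exact: subgroupM.
Qed.

End TopologicalGroups.

(** * Generators from the rank bound, and index bounds in the limit *)

Section FiniteRank.
Variable G : topologicalGroupType.
Implicit Types (A H K M N U V : set G) (x y g : G).

Lemma min_gensP H : top_fg H -> topgen_cards H (min_gens H).
Proof.
move=> [X [/finite_fsetP[F XE] XH HX]].
have ex : exists n, `[< topgen_cards H n >].
  exists (size (enum_fset F)); apply/asboolP; exists X; split=> //.
  by rewrite XE; apply/card_eq_fsetP.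
suff [] : [set n | topgen_cards H n /\ lbound (topgen_cards H) n] (min_gens H)
  by [].
apply: getPex; exists (ex_minn ex); case: ex_minnP => m /asboolP Hm mmin.
by split=> // k Hk; rewrite leEnat; apply: mmin; apply/asboolP.
Qed.

(** [A] is not assumed topologically finitely generated, so the rank bound is applied to the closed
    subgroup generated by finitely many representatives of the cosets of [N] in [A]. Together with
    [N] that subgroup generates [A]. *)
Lemma rank_generators (r : nat) A N : ubound (gens_numbers G) r ->
  compact A -> subgroup A -> open N -> subgroup N -> N `<=` A ->
  exists Y : seq G, [/\ (size Y <= r)%N, forall y, y \in Y -> A y
    & A `<=` subgroup_generated ([set` Y] `|` N)].
Proof.
move=> rG cA sA oN sN NA.
have N1 := open_subgroup_nbhs sN oN.
have clA : closed A.
  apply: open_subgroup_closed => //; apply: subgroup_open => //.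
  exact: filterS N1.
have [n cov] := compact_coset_covered cA N1.
have [s _ [sA' sN']] := coset_covered_inner sN cov.
pose H := topgen [set` s].
have sH : subgroup H by exact: subgroup_topgen.
have HA : H `<=` A by exact: topgen_min.
have fgH : top_fg H.
  by exists [set` s]; split=> //; [exact: finite_seq|exact: sub_topgen].
have [Y [cY YH YE]] := min_gensP fgH.
have Hr : (min_gens H <= r)%N.
  by rewrite -leEnat; apply: rG; exists H => //; split=> //;
    exact: closed_closure.
have /finite_fsetP[F FE] : finite_set Y by exists (min_gens H).
exists (enum_fset F); split.
- move: cY; rewrite FE => /card_eq_fsetP E; by rewrite E.
- by move=> y yF; apply/HA/YH; rewrite FE.
have sg := subgroup_generated_subgroup ([set` F] `|` N).
have YN : topgen Y `<=` subgroup_generated ([set` F] `|` N).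
  move=> x /(topgen_subM sN oN)[a Ya [b Nb <-]].
  apply: (subgroupM sg).
    by apply: subgroup_generatedS Ya => z; rewrite FE; left.
  by apply: sub_subgroup_generated; right.
move=> a /sN'[x xs Nx]; rewrite -(mulVKg x a).
apply: (subgroupM sg).
  by apply: YN; rewrite YE; exact: sub_topgen.
by apply: sub_subgroup_generated; right.
Qed.

Lemma near_all_seq (T : eqType) (I : Type) (F : set_system I) (s : seq T)
    (P : T -> I -> Prop) : Filter F ->
  (forall x : T, x \in s -> \forall i \near F, P x i) ->
  \forall i \near F, forall x : T, x \in s -> P x i.
Proof.
move=> FF; elim: s => [|a s IH] sP; first by apply: nearW.
have Fa := sP a (mem_head _ _).
have Fs : \forall i \near F, forall x : T, x \in s -> P x i.
  by apply: IH => x xs; apply: sP; rewrite inE xs orbT.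
apply: filterS2 Fa Fs => i Pa Ps x.
by rewrite inE => /predU1P[->//|]; exact: Ps.
Qed.

(* Otherwise A contains n + 1 points in distinct cosets of H; as H is closed,
   these points stay in distinct cosets of HN for small N. *)
Lemma coset_covered_limit A H n : subgroup H -> closed H ->
  (forall V, nbhs (1 : G) V -> exists N, [/\ N `<=` V, subgroup N,
    subgroup (setM H N) & coset_covered A (setM H N) n]) ->
  coset_covered A H n.
Proof.
move=> sH cH HN; apply: contrapT => ncov.
have [s [ss sA sH']] : exists s : seq G, [/\ size s = n.+1,
    forall x, x \in s -> A x & pairwise (fun x y => ~~ `[< H (y^-1 * x) >]) s].
  have : (n.+1 <= n.+1)%N by [].
  (* Points are chosen greedily: at most [n] of them cannot represent every coset of [H] that meets
     [A], so another one can be added. *)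
  elim: {1 3}n.+1 => [|j IH] jn; first by exists [::].
  have [s [sj sA sH']] := IH (ltnW jn).
  have [a Aa sa] : exists2 a, A a & forall x, x \in s -> ~ H (x^-1 * a).
    apply: contrapT => noa; apply: ncov; exists s; first by rewrite sj.
    move=> a Aa; apply: contrapT => nx; apply: noa; exists a => // x xs Hx.
    by apply: nx; exists x.
  exists (a :: s); split=> /=; first by rewrite sj.
    by move=> x; rewrite inE => /predU1P[->|/sA].
  rewrite sH' andbT; apply/allP => x xs; apply/asboolPn; exact: sa.
(* If [N] lies in [V], then [y^-1 * x] outside [H] is also outside [HN], for all [x] and [y] in
   [s]. *)
pose V := [set g | forall x, x \in s -> forall y, y \in s ->
  ~ H (y^-1 * x) -> ~ H (y^-1 * x * g^-1)].
have V1 : nbhs (1 : G) V.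
  apply: near_all_seq => x xs; apply: near_all_seq => y ys.
  have [Hyx|nHyx] := pselect (H (y^-1 * x)); first by apply: nearW.
  have : nbhs (1 : G) [set g | (~` H) (y^-1 * x * g^-1)].
    have c : (fun g : G => y^-1 * x * g^-1) @ nbhs 1 --> y^-1 * x * 1^-1.
      by apply: cvgMg; [exact: cvg_cst|apply: cvgVg; exact: cvg_id].
    apply: c; apply: open_nbhs_nbhs; split; first exact: closed_openC.
    by rewrite invg1 mulg1.
  by apply: filterS => g Hg _.
have [N [NV sN sHN [t tn At]]] := HN V V1.
have /choice[f ft] : forall x, exists y, x \in s ->
  y \in t /\ setM H N (y^-1 * x).
  move=> x.
  have [xs|xs] := pselect (x \in s); last by exists 1.
  by have [y yt Hy] := At x (sA x xs); exists y.
(* Points of [s] with the same representative in [t] would lie in one coset of [HN], so [f] injects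
   [n + 1] points into at most [n]. *)
have : uniq (map f s).
  rewrite uniq_pairwise pairwise_map.
  apply: sub_in_pairwise (allss s) sH'.
  move=> x y /= xs ys /asboolPn nH; apply/negP => /eqP fxy.
  have [_ Hx] := ft x xs; have [_ Hy] := ft y ys.
  have [h Hh [g Ng hgE]] : setM H N (y^-1 * x).
    have -> : y^-1 * x = ((f y)^-1 * y)^-1 * ((f x)^-1 * x).
      by rewrite fxy !gnorm.
    by apply: subgroupM => //; exact: subgroupV.
  apply: (NV g Ng x xs y ys nH); by rewrite -hgE mulgK.
have ftE : {subset map f s <= t} by move=> _ /mapP[x /ft[xt _] ->].
by move=> /uniq_leq_size /(_ ftE); rewrite size_map ss leqNgt ltnS tn.
Qed.

End FiniteRank.

(** * The filtration by powers *)

Section PowerFiltration.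
Variables (G : topologicalGroupType) (p : nat) (U : set G).
Hypotheses (p_gt0 : (0 < p)%N) (cU : compact U) (oU : open U) (sU : subgroup U).
Implicit Types (N V : set G).

Definition power_filtration (k : nat) : set G :=
  topgen [set u ^+ (p ^ k) | u in U].
Local Notation W := power_filtration.

Lemma subgroup_power_filtration k : subgroup (W k).
Proof. exact: subgroup_topgen. Qed.

Lemma closed_power_filtration k : closed (W k).
Proof. exact: closed_closure. Qed.

Lemma power_filtration_sub k : W k `<=` U.
Proof.
apply: topgen_min => //; first exact: open_subgroup_closed.
by move=> _ [u Uu <-]; exact: subgroupX.
Qed.

Lemma sub_power_filtration0 : U `<=` W 0.
Proof. by move=> u Uu; apply: sub_topgen; exists u. Qed.

Lemma power_filtration_decr k m : W (k + m) `<=` W k.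
Proof.
apply: topgen_min (subgroup_topgen _) (@closed_closure _ _) _ => _ [u Uu <-].
apply: sub_topgen; exists (u ^+ (p ^ m)); first exact: subgroupX.
by rewrite -expgnA -expnD addnC.
Qed.

Lemma normalizes_power_filtration k : normalizes U (W k).
Proof.
have nW : normalizes U (subgroup_generated [set u ^+ (p ^ k) | u in U]).
  apply: normalizes_generated => _ y [u Uu <-] Uy; rewrite conjXg.
  by apply: sub_subgroup_generated; exists (u ^ y) => //; exact: subgroupJ.
move=> x y Wx Uy V Vxy.
have c : (fun z : G => z ^ y) @ nbhs x --> x ^ y.
  by apply: cvgMg; [exact: cvg_cst|apply: cvgMg;
    [exact: cvg_id|exact: cvg_cst]].
have [z [Wz Vz]] := Wx _ (c _ Vxy).
by exists (z ^ y); split=> //; exact: nW.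
Qed.

(** Each [x] in [U] has a power [x ^+ (p ^ k)] in [V], and so do nearby points. As [V] is a
    subgroup, larger exponents also work, and compactness of [U] yields a common [k]. *)
Lemma power_filtration_base V : topological_p_group p G ->
  open V -> subgroup V -> exists k, W k `<=` V.
Proof.
move=> pG oV sV.
have : \forall k \near \oo, U `<=` (fun x => V (x ^+ (p ^ k))).
  move: cU => /compact_near_coveringP; apply => x Ux.
  have [k _ Vk] := pG x V (open_subgroup_nbhs sV oV).
  have Vx : nbhs x [set z | V (z ^+ (p ^ k))].
    apply: (@expgn_continuous G (p ^ k) x); apply: open_nbhs_nbhs; split=> //.
    by apply: Vk => /=.
  exists ([set z | V (z ^+ (p ^ k))], [set j | (k <= j)%N]).
    by split=> //; exists k.
  move=> [z j] /= [Vz kj].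
  by rewrite -(subnKC kj) expnD expgnA; exact: subgroupX.
move=> [k _ /(_ k (leqnn k)) Uk]; exists k.
apply: topgen_min => //; first exact: open_subgroup_closed.
by move=> _ [u /Uk Vu <-].
Qed.

(** The preimage of [W k] is a closed subgroup, so it suffices to treat the generators, where
    [phi (u ^+ (p ^ m))] is an element of [U] raised to the power [p ^ k]. *)
Lemma power_filtration_morph (phi : G -> G) k m : {morph phi : x y / x * y} ->
  continuous phi -> W m `<=` phi @^-1` U -> W (k + m) `<=` phi @^-1` W k.
Proof.
move=> phiM phic phiU.
apply: topgen_min.
- exact: subgroup_preimage (subgroup_power_filtration k).
- apply: closed_comp; last exact: closed_power_filtration.
  by move=> x _; exact: phic.
move=> _ [u Uu <-]; rewrite addnC expnD expgnA /= (morphX phiM).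
apply: sub_topgen; exists (phi (u ^+ (p ^ m))) => //.
by apply: phiU; apply: sub_topgen; exists u.
Qed.

Hypotheses (hG : hausdorff_space G) (lG : locally_compact [set: G]).
Hypothesis cc1 : connected_component [set: G] 1 = [set 1].

(** The nilpotent index bound is applied to [W k] and [W (k + m)] thickened by a small open [N]
    normalized by [U], since the rank argument works modulo an open subgroup. The bound is
    independent of [N], so [N] can be shrunk away. *)
Lemma power_filtration_covered (r c k m : nat) : ubound (gens_numbers G) r ->
  @lower_central G c = [set 1] ->
  coset_covered (W k) (W (k + m)) (((p ^ m) ^ r) ^ c).
Proof.
move=> rG Gc.
apply: coset_covered_limit.
- exact: subgroup_power_filtration.
- exact: closed_power_filtration.
move=> V V1.
have [N0 [N0V _ oN0 sN0]] : exists N, [/\ N `<=` V `&` U, compact N, open N &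
  subgroup N].
  by apply: open_subgroup_base => //; apply: filterI => //;
    exact: open_subgroup_nbhs.
have [N [NN0 oN sN nN]] := normal_open_core cU sU oN0 sN0.
have NU : N `<=` U by move=> x /NN0/N0V[].
have sW i := subgroup_power_filtration i.
have nWN i : normalizes (W i) N by exact: normalizesS (@power_filtration_sub i)
  nN.
pose K := setM (W k) N; pose M := setM (W (k + m)) N.
have sK : subgroup K by exact: subgroup_setM.
have sM : subgroup M by exact: subgroup_setM.
have MK : M `<=` K by apply: setMS; exact: power_filtration_decr.
have KU : K `<=` U by apply: setM_min => //; exact: power_filtration_sub.
have nM : normalizes K M.
  apply: normalizesS KU _; apply: normalizes_setM nN.
  exact: normalizes_power_filtration.
exists N; split=> //; first by move=> x /NN0/N0V[].
apply: (@coset_coveredS _ K _ M _ (((p ^ m) ^ r) ^ c)) => //;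
  first exact: sub_setMl.
have NM : N `<=` M by exact: sub_setMr.
pose S := [set u ^+ (p ^ k) | u in U].
have SW : S `<=` W k by exact: sub_topgen.
apply: (@coset_covered_nilpotent G K M sK sM MK nM (p ^ m) S) => //.
- by move=> x /SW Wx; exact: sub_setMl.
- move=> _ [x /(topgen_subM sN oN)[y Sy [z Nz <-]] [n Nn <-]].
  have sg := subgroup_generated_subgroup (S `|` M).
  have Mg z' : N z' -> subgroup_generated (S `|` M) z'.
    by move=> Nz'; apply: sub_subgroup_generated; right; exact: NM.
  apply: (subgroupM sg); last exact: Mg.
  apply: (subgroupM sg); last exact: Mg.
  by apply: subgroup_generatedS Sy => s; left.
- move=> _ [u Uu <-]; rewrite -expgnA -expnD; apply: sub_setMl => //.
  by apply: sub_topgen; exists u.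
- by rewrite expn_gt0 p_gt0.
move=> A sA MA AK.
(* [A] contains the open subgroup [N], hence is open, hence closed in the compact [U]. *)
have cA : compact A.
  apply: subclosed_compact (subset_trans AK KU) => //.
  apply: open_subgroup_closed => //; apply: subgroup_open => //.
  by apply: filterS (open_subgroup_nbhs sN oN) => x /NM /MA.
have [Y [Yr YA AY]] := rank_generators rG cA sA oN sN (subset_trans NM MA).
exists Y; split=> //; apply: subset_trans AY _; apply: subgroup_generatedS => x.
by move=> [Yx|/NM Mx]; [left|right].
Qed.

End PowerFiltration.

(** * Exponential index bounds for cotrajectories *)

Section Cotrajectory.
Variable G : topologicalGroupType.

Lemma cotrajectory_closed (phi : G -> G) (V : set G) n :
  continuous phi -> closed V -> closed (cotrajectory phi V n).
Proof.
move=> phic cV; apply: closed_bigI => k _; apply: closed_comp cV => x _.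
elim: k x => [|k IH] x; first exact: cvg_id.
exact: (@continuous_comp _ _ _ (iter k phi) phi x (IH x) (phic _)).
Qed.

Variables (p : nat) (U : set G) (phi : G -> G).
Hypotheses (p_gt0 : (0 < p)%N) (cU : compact U) (oU : open U) (sU : subgroup U).
Hypotheses (hG : hausdorff_space G) (lG : locally_compact [set: G]).
Hypotheses (cc1 : connected_component [set: G] 1 = [set 1]).
Hypotheses (pG : topological_p_group p G) (nilG : nilpotent_group G).
Hypotheses (rG : finite_rank G) (phiA : continuous_automorphism phi).

(** The order of quantifiers matters: only [a], which bounds the index of some [W k] inside [V],
    depends on [V]. The growth rate [b] depends on [phi] alone, through [m], and so bounds the
    entropy uniformly in [V]. *)
Lemma cotrajectory_covered : exists2 b, (0 < b)%N &
  forall V, nbhs (1 : G) V -> exists2 a, (0 < a)%N &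
    forall n, exists D, [/\ closed D, D `<=` cotrajectory phi V n
      & coset_covered U D (a * b ^ n)].
Proof.
have [c Gc] := nilG; have [r [_ Gr]] := rG.
have [phiM phic [psi [phiK psiK _]]] := phiA.
pose W := power_filtration p U.
have [m Wm] : exists m, W m `<=` phi @^-1` U.
  apply: power_filtration_base => //; last exact: subgroup_preimage.
  by apply: open_comp => // x _; exact: phic.
have covW k j := power_filtration_covered p_gt0 cU oU sU hG lG cc1 k j Gr Gc.
exists (((p ^ m) ^ r) ^ c)%N; first by rewrite !expn_gt0 p_gt0.
move=> V V1.
have [N [NV _ oN sN]] := open_subgroup_base hG lG cc1 V1.
have [k Wk] : exists k, W k `<=` N by exact: power_filtration_base.
exists (((p ^ k) ^ r) ^ c)%N; first by rewrite !expn_gt0 p_gt0.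
(* The index bound [b ^ n] is available for the cotrajectory of length [n.+1], which is contained in
   the one of length [n]. *)
move=> n; exists (cotrajectory phi (W k) n.+1); split.
- by apply: cotrajectory_closed => //; exact: closed_power_filtration.
- by move=> x Wx j jn; apply/NV/Wk/Wx; exact: ltnW.
apply: coset_covered_trans; last first.
  apply: (coset_covered_cotrajectory phiM psiK) _ _;
    first exact: subgroup_power_filtration.
  apply: coset_coveredS (covW k m) => //.
  move=> x Wx; split; last exact: power_filtration_decr Wx.
  exact: (power_filtration_morph phiM phic Wm) Wx.
apply: coset_coveredS (covW 0 k) => //.
exact: sub_power_filtration0.
Qed.

End Cotrajectory.

(** * Haar measure and entropy *)

Section Haar.
Local Open Scope ring_scope.
Variables (R : realType) (G : topologicalGroupType).
Variable mu : {measure set (borel G) -> \bar R}.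
Hypotheses (hG : hausdorff_space G) (mu_haar : left_haar mu).
Local Open Scope ereal_scope.
Implicit Types A H U : set G.

Lemma closed_borel A : closed A -> measurable (A : set (borel G)).
Proof.
move=> cA; rewrite -(setCK A); apply: measurableC.
by apply: sub_sigma_algebra; exact: closed_openC.
Qed.

(** [A] lies in a union of at most [n] left translates of [H], all of the same measure. *)
Lemma haar_coset_covered A H n : closed A -> closed H -> coset_covered A H n ->
  mu A <= n%:R%:E * mu H.
Proof.
move=> cA cH [s sn sA].
have [_ muL _ _ _] := mu_haar.
pose xH (x : G) : set G := [set (x * y)%g | y in H].
have mxH x : measurable (xH x : set (borel G)).
  apply: closed_borel.
  rewrite (_ : xH x = (fun y => x^-1 * y)%g @^-1` H).
    by apply: closed_comp cH => y _; exact: mulgl_continuous.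
  apply/seteqP; split=> [_ [y Hy <-]|y Hy] /=; first by rewrite mulKg.
  by exists (x^-1 * y)%g; rewrite ?mulVKg.
have mH : measurable (H : set (borel G)) by exact: closed_borel.
pose B : set (borel G) := \big[setU/set0]_(x <- s) xH x.
have mB : measurable B by apply: bigsetU_measurable => x _.
apply: (@le_trans _ _ (mu B)).
  apply: le_measure; rewrite ?inE//; first exact: closed_borel.
  move=> a /sA[x xs Hx]; rewrite /B -bigcup_seq; exists x => //=.
  by exists (x^-1 * a)%g; rewrite ?mulVKg.
apply: (@le_trans _ _ ((size s)%:R%:E * mu H)); last first.
  by apply: lee_wpmul2r => //; rewrite lee_fin ler_nat.
rewrite /B; elim: s {sn sA B mB} => [|x s IH].
  by rewrite big_nil measure0 mul0e.
rewrite big_cons /= -natr1 EFinD ge0_muleDl// mul1e addeC.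
apply: le_trans (measureU2 _ _ _) _ => //.
  by apply: bigsetU_measurable => y _.
by apply: leeD => //; rewrite [leLHS](muL x H mH).
Qed.

(** If [U] were null, so would be every compact set, being covered by finitely many cosets of [U];
    inner regularity on the open set [G] would then make the whole measure zero. *)
Lemma haar_open_subgroup_gt0 U : open U -> subgroup U -> 0 < mu U.
Proof.
move=> oU sU; rewrite lt0e measure_ge0 andbT; apply/eqP => muU.
have [/eqP mu0 _ _ _ muK] := mu_haar; apply: mu0.
apply/eqP; rewrite eq_le measure_ge0 andbT muK; last exact: openT.
apply: ge_ereal_sup => _ [K [cK _] <-].
have [n cov] := compact_coset_covered cK (open_subgroup_nbhs sU oU).
have -> : 0 = n%:R%:E * mu U by rewrite muU mule0.
apply: haar_coset_covered cov; first exact: compact_closed.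
exact: open_subgroup_closed.
Qed.

End Haar.

(** * Upper limits and a logarithmic estimate *)

Section LimnEsup.
Variable R : realType.
Local Open Scope ereal_scope.
Implicit Types (u : (\bar R)^nat) (l : \bar R).

Lemma limn_esup_le_near u l : (\forall n \near \oo, u n <= l) ->
  limn_esup u <= l.
Proof.
move=> [N _ uN]; rewrite /limn_esup limf_esupE.
apply: (@le_trans _ _ (ereal_sup [set u n | n in [set n | (N <= n)%N]])).
  by apply: ereal_inf_lbound; exists [set n | (N <= n)%N] => //; exists N.
by apply: ge_ereal_sup => _ [n Nn <-]; exact: uN.
Qed.

Lemma limn_esup_ge_near u l : (\forall n \near \oo, l <= u n) ->
  l <= limn_esup u.
Proof.
move=> lu; rewrite /limn_esup limf_esupE;
  apply: le_ereal_inf_tmp => _ [A A_oo <-].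
have [n [An ln]] := @filter_ex _ \oo _ _ (filterI A_oo lu).
by apply: le_trans ln (ereal_sup_ubound _); exists n.
Qed.

Local Open Scope ring_scope.

Lemma oppr_ln_le (x y a b : R) (n : nat) : 0 < x -> 0 < y -> 0 < a -> 0 < b ->
  x <= a * b ^+ n * y -> - ln y <= ln a - ln x + n%:R * ln b.
Proof.
move=> x0 y0 a0 b0 xy.
have bn0 : 0 < b ^+ n by exact: exprn_gt0.
have abn0 : 0 < a * b ^+ n by exact: mulr_gt0.
have : ln x <= ln (a * b ^+ n * y) by rewrite ler_ln ?posrE ?mulr_gt0.
rewrite lnM ?posrE// lnM ?posrE// lnXn// -mulr_natl; lra.
Qed.

End LimnEsup.

(** * Lower and upper bounds for the entropy terms *)

Section EntropyBounds.
Local Open Scope ring_scope.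
Variables (R : realType) (G : topologicalGroupType).
Variable mu : {measure set (borel G) -> \bar R}.
Hypotheses (hG : hausdorff_space G) (mu_haar : left_haar mu).
Variables (phi : G -> G) (phic : continuous phi).
Local Open Scope ereal_scope.
Implicit Types (U V : set G) (a b n : nat).

Local Notation term V n :=
  (- lne (mu (cotrajectory phi V n)) * (n%:R^-1)%R%:E).

Let borel_cotrajectory V n : compact V ->
  measurable (cotrajectory phi V n : set (borel G)).
Proof.
by move=> cV; apply: closed_borel; apply: cotrajectory_closed => //;
  exact: compact_closed.
Qed.

Lemma le_haar_cotrajectory V n : (0 < n)%N -> compact V ->
  mu (cotrajectory phi V n) <= mu V.
Proof.
move=> n0 cV; apply: le_measure; rewrite ?inE.
- exact: borel_cotrajectory.
- by apply: closed_borel; exact: compact_closed.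
- by move=> x /(_ 0%N n0).
Qed.

Lemma limn_esup_term_gtNy V : compact V ->
  -oo < limn_esup (fun n => term V n).
Proof.
move=> cV; have [_ _ mufin _ _] := mu_haar.
(* The maximum with 1 makes [ln v] nonnegative, so that [- ln v / n] is at least [- ln v] for all
   positive [n]. *)
pose v := Num.max (fine (mu V)) 1%R.
have v1 : (1 <= v)%R by rewrite le_max lexx orbT.
have muv : mu V <= v%:E.
  rewrite -[mu V]fineK ?lee_fin ?le_max ?lexx// ge0_fin_numE//.
  exact: mufin.
apply: (@lt_le_trans _ _ (- ln v)%:E); first by rewrite ltNyr.
apply: limn_esup_ge_near; exists 1%N => // n /= n0.
have lv0 : (0 <= ln v)%R by exact: ln_ge0.
apply: (@le_trans _ _ ((- ln v)%:E * (n%:R^-1)%R%:E)).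
  rewrite -EFinM lee_fin mulNr lerN2 ler_piMr// invf_le1 ?ler1n ?ltr0n//.
apply: lee_wpmul2r; first by rewrite lee_fin invr_ge0.
have v0 : (0 < v)%R by exact: lt_le_trans v1.
have muCv := le_trans (le_haar_cotrajectory n0 cV) muv.
rewrite EFinN leeN2 -lne_EFin// lee_lne// in_itv/= leey andbT.
  exact: measure_ge0.
by rewrite lee_fin ltW.
Qed.

(** The covering gives that [mu U] is at most [a * b ^ n] times the measure of the cotrajectory.
    Taking logarithms and dividing by [n] leaves [ln b] plus a constant over [n]. *)
Lemma limn_esup_term_le U V a b : compact U -> 0 < mu U -> (0 < a)%N ->
  (0 < b)%N ->
  compact V ->
  (forall n, exists D, [/\ closed D, D `<=` cotrajectory phi V n
      & coset_covered U D (a * b ^ n)]) ->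
  limn_esup (fun n => term V n) <= (ln b%:R + 1)%:E.
Proof.
move=> cU muU a0 b0 cV cov; have [_ _ mufin _ _] := mu_haar.
have clU : closed U by exact: compact_closed.
have muUfin : mu U \is a fin_num by rewrite ge0_fin_numE//; exact: mufin.
pose x := fine (mu U).
have x0 : (0 < x)%R by rewrite fine_gt0// muU/= -ge0_fin_numE.
(* Once [n] exceeds [c], this constant contributes at most 1 after division by [n]. *)
pose c : R := (ln a%:R - ln x)%R.
apply: limn_esup_le_near; near=> n.
have n0 : (0 < n)%N by near: n; exists 1%N.
have cn : (c <= n%:R)%R by near: n; exact: nbhs_infty_ger.
have [D [cD DV covD]] := cov n.
set C := cotrajectory phi V n in DV *.
have muCfin : mu C \is a fin_num.
  by rewrite ge0_fin_numE//;
    apply: le_lt_trans (le_haar_cotrajectory n0 cV) (mufin _ cV).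
have xC : (x <= a%:R * b%:R ^+ n * fine (mu C))%R.
  rewrite -lee_fin EFinM /x !fineK// -natrX -natrM.
  apply: le_trans (haar_coset_covered mu_haar clU cD covD) _.
  apply: lee_wpmul2l => //; apply: le_measure; rewrite ?inE//.
    exact: closed_borel.
  exact: borel_cotrajectory.
(* A null cotrajectory would force [mu U] to vanish; positivity keeps the logarithm finite. *)
have C0 : (0 < fine (mu C))%R.
  rewrite lt_neqAle fine_ge0 ?measure_ge0// andbT eq_sym; apply/eqP => C0.
  by move: xC; rewrite C0 mulr0 leNgt x0.
rewrite -[mu C]fineK// lne_EFin// -EFinN -EFinM lee_fin.
rewrite ler_pdivrMr ?ltr0n//.
apply: le_trans (oppr_ln_le x0 C0 _ _ xC) _; rewrite ?ltr0n//.
by rewrite -/c mulrDl mul1r addrC mulrC lerD2l.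
Unshelve. all: by end_near. Qed.

End EntropyBounds.

Local Open Scope ring_scope.

Theorem theorem1p4 (R : realType) (p : nat) (G : topologicalGroupType)
    (mu : {measure set (borel G) -> \bar R})
    (p_prime : prime p)
    (G_lc : locally_compact_group G)
    (mu_haar : left_haar mu)
    (G_periodic : periodic_group G)
    (G_p_group : topological_p_group p G)
    (G_nilpotent : nilpotent_group G)
    (G_rank : finite_rank G)
    (phi : G -> G)
    (phi_aut : continuous_automorphism phi) :
  htop mu phi \is a fin_num.
Proof.
have [hG lG] := G_lc; have [cc1 _] := G_periodic; have [_ phic _] := phi_aut.
have [U [_ cU oU sU]] := open_subgroup_base hG lG cc1 filterT.
have [b b0 cov] := cotrajectory_covered (prime_gt0 p_prime) cU oU sU hG lG cc1
  G_p_group G_nilpotent G_rank phi_aut.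
(* One compact neighbourhood of 1 keeps the supremum above [-oo]. *)
have [K] := lG 1%g I; rewrite withinET => K1 [cK _].
rewrite fin_numE; apply/andP; split; rewrite -?ltNye -?ltey.
  apply: lt_le_trans (limn_esup_term_gtNy hG mu_haar phic cK) _.
  by apply: ereal_sup_ubound; exists K.
apply: le_lt_trans (ltry (ln b%:R + 1)).
apply: ge_ereal_sup => _ [V [V1 cV] <-].
have [a a0 covV] := cov V V1.
exact: (limn_esup_term_le hG mu_haar phic cU (haar_open_subgroup_gt0 hG mu_haar
  oU sU) a0 b0 cV covV).
Qed.
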